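(* Let $2\le n\le 4$ and let $P^n_\omega$ be a non-trivially weighted edge-weighted path whose edge ideal $I=I(P^n_\omega)\subseteq S=\mathbb{K}[x_1,\dots,x_n]$ is integrally closed, with vertices $x_1,\dots,x_n$, edges $e_i=\{x_i,x_{i+1}\}$ and weights $\omega_i=\omega(e_i)$, $i\in[n-1]$. Let $\omega=\max\{\omega_1,\dots,\omega_{n-1}\}$. Then: (1) if $n=2$, $\operatorname{reg}(S/I)=2\omega-1$ and $\operatorname{depth}(S/I)=1$; (2) if $n=3$, $\operatorname{reg}(S/I)=2\omega-1$ and $\operatorname{depth}(S/I)=1$; (3) if $n=4$, $\operatorname{reg}(S/I)=2\omega-1$ and $\operatorname{depth}(S/I)=2-a$, where $a=0$ if $\omega_2=1$ and $a=1$ otherwise.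
   Context: $\mathbb{K}$ is a field. For a simple graph $G$ with weight function $\omega:E(G)\to\mathbb{Z}_{>0}$, $I(G_\omega)=(x_i^{\omega(e)}x_j^{\omega(e)}\mid e=\{x_i,x_j\}\in E(G))$. An edge $e$ has non-trivial weight if $\omega(e)\ge2$; a weighted graph is non-trivially weighted if some edge has non-trivial weight. An ideal is integrally closed if it equals its integral closure. For such paths, integral closedness implies in particular that no two adjacent edges both have non-trivial weight (so for $n=3$ exactly one edge is non-trivial, and for $n=4$ either $\omega_2=1$ or $\omega_1=\omega_3=1$). *)

(* Defs.v *)
From HB Require Import structures.
From mathcomp Require Import all_boot all_order all_algebra.
From mathcomp Require Import mpoly.
Set Implicit Arguments. Unset Strict Implicit. Unset Printing Implicit Defensive.
Import Order.TTheory GRing.Theory.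
Local Open Scope ring_scope.

Section Defs.
Variables (K : fieldType) (n : nat).
Local Notation S := {mpoly K[n]}.

Definition in_ideal (s : seq S) (f : S) : Prop :=
  exists c : 'I_(size s) -> S, f = \sum_(k < size s) c k * s`_k.

Fixpoint pow_gens (s : seq S) (k : nat) : seq S :=
  if k is k'.+1 then [seq a * b | a <- s, b <- pow_gens s k'] else [:: 1].

Definition integral_over_ideal (s : seq S) (f : S) : Prop :=
  exists (k : nat) (a : nat -> S), (0 < k)%N /\
    (forall i, (0 < i <= k)%N -> in_ideal (pow_gens s i) (a i)) /\
    f ^+ k + \sum_(1 <= i < k.+1) a i * f ^+ (k - i) = 0.

Definition integrally_closed (s : seq S) : Prop :=
  forall f, integral_over_ideal s f -> in_ideal s f.

(* Koszul complex K(x_1..x_n; S): a chain assigns to each subset F of the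
   variables the coefficient of the basis element e_F (of internal degree |F|). *)
Definition koszul_d (c : {set 'I_n} -> S) (G : {set 'I_n}) : S :=
  \sum_(k : 'I_n | k \notin G)
     (-1) ^+ #|[set l in G | (l < k)%N]| * 'X_k * c (k |: G).

(* Tor_i^S(K, S/I)_j <> 0, computed with the Koszul resolution of K:
   H_i(K(x) (x) S/I) in degree j is nonzero. *)
Definition tor_nz (s : seq S) (i j : nat) : Prop :=
  (i <= j)%N /\
  exists c : {set 'I_n} -> S,
    [/\ forall F : {set 'I_n}, #|F| != i -> c F = 0,
        forall F : {set 'I_n}, c F \is (j - i)%N.-homog,
        forall G : {set 'I_n}, in_ideal s (koszul_d c G)
      & ~ exists b : {set 'I_n} -> S,
            [/\ forall F : {set 'I_n}, #|F| != i.+1 -> b F = 0,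
                forall F : {set 'I_n}, b F \is (j - i).-1.-homog,
                (i < j)%N \/ (forall F : {set 'I_n}, b F = 0)
              & forall F : {set 'I_n}, in_ideal s (c F - koszul_d b F)]].

Definition betti_nz (s : seq S) (i j : nat) : Prop := tor_nz s i j.

Definition reg_eq (s : seq S) (r : nat) : Prop :=
  (exists i j, betti_nz s i j /\ j = (i + r)%N) /\
  (forall i j, betti_nz s i j -> (j <= i + r)%N).

Definition in_max_ideal (f : S) : bool := f@_0%MM == 0.

Definition regular_seq (s : seq S) (fs : seq S) : Prop :=
  all in_max_ideal fs /\
  (forall k, (k < size fs)%N -> forall g : S,
      in_ideal (s ++ take k fs) (g * fs`_k) -> in_ideal (s ++ take k fs) g) /\
  ~ in_ideal (s ++ fs) 1.

Definition depth_eq (s : seq S) (d : nat) : Prop :=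
  (exists fs, size fs = d /\ regular_seq s fs) /\
  (forall fs, regular_seq s fs -> (size fs <= d)%N).

(* the variable x_{i+1} (0-indexed as i); only used for i < n *)
Definition xvar (i : nat) : S :=
  if @insub nat (fun k => (k < n)%N) 'I_n i is Some k then 'X_k else 0.

Definition path_gens (w : nat -> nat) : seq S :=
  [seq (xvar i * xvar i.+1) ^+ (w i) | i <- iota 0 n.-1].

End Defs.

(* Main.v *)
Require Import Defs.
From HB Require Import structures.
From mathcomp Require Import all_boot all_order all_algebra.
From mathcomp Require Import mpoly.
From mathcomp Require Import ring zify.

(* Both invariants are read off Koszul homology H_i(x; S/I).  Vanishing in large
   internal degree is proved through the sequences
   0 -> S/(I : x_k)(-1) -> S/I -> S/(I, x_k) -> 0, which reduce the path ideals to
   ideals (x_i^a x_j^b) plus variables; a variable that is regular modulo I costs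
   no degree, because multiplication by x_k is null-homotopic.
   Conversely, if x_i^w x_j^w is the generator of maximal weight and B is the set
   of the other neighbours of the edge used, then x_i^(w-1) x_j^w e_({i} u B) is a
   nonzero class of internal degree |B| + 2w.  It attains the regularity, and it
   bounds the depth: the homotopy attached to an I-regular f in the maximal ideal
   turns a nonzero class of H_p(x; S/I) into one of H_(p+1)(x; S/(I, f)), and
   H_p = 0 for p > n.  The matching regular sequences are x + y for n <= 3,
   x + y, z + t for n = 4 with the middle weight 1, and x t + y + z otherwise. *)
Set Implicit Arguments. Unset Strict Implicit. Unset Printing Implicit Defensive.

(** * Ideals of the polynomial ring, as predicates and as lists of generators *)

Section Generated.
Import Order.TTheory GRing.Theory.
Local Open Scope ring_scope.
Variables (K : fieldType) (n : nat).
Local Notation S := {mpoly K[n]}.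
Implicit Types (f g h : S) (s fs : seq S) (I : S -> Prop).

Definition is_ideal I :=
  [/\ I 0, forall f g, I f -> I g -> I (f + g) & forall h f, I f -> I (h * f)].

(** Membership of [g] in the ideal I + (f). By [in_ideal_rcons] this is what appending one element
    to the generators does, so each step of a regular sequence can be treated without lists. *)
Definition adjoin I f g := exists h, I (g - h * f).

Lemma idealB I f g : is_ideal I -> I f -> I g -> I (f - g).
Proof. by case=> _ ID IM If Ig; apply: ID => //; rewrite -mulN1r; apply: IM. Qed.

Lemma ideal_sum I (T : Type) (r : seq T) (p : pred T) (F : T -> S) :
  is_ideal I -> (forall t, p t -> I (F t)) -> I (\sum_(t <- r | p t) F t).
Proof. by case=> I0 ID _ IF; elim/big_ind: _. Qed.

Lemma in_ideal_cons a s f : in_ideal (a :: s) f <-> adjoin (in_ideal s) a f.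
Proof.
split=> [[c ->]|[h [c fE]]].
  exists (c ord0), (fun k => c (lift ord0 k)).
  by rewrite big_ord_recl /= addrC addKr.
exists (fun k => if unlift ord0 k is Some k' then c k' else h).
rewrite big_ord_recl /= unlift_none.
under eq_bigr do rewrite liftK.
by rewrite -fE addrC subrK.
Qed.

Lemma in_ideal_ideal s : is_ideal (in_ideal s).
Proof.
split.
- by exists (fun=> 0); rewrite big1 // => k _; rewrite mul0r.
- move=> f g [c ->] [e ->]; exists (fun k => c k + e k).
  by rewrite -big_split /=; apply: eq_bigr => k _; rewrite mulrDl.
- move=> h f [c ->]; exists (fun k => h * c k).
  by rewrite mulr_sumr; apply: eq_bigr => k _; rewrite mulrA.
Qed.

Lemma in_ideal_mem s f : f \in s -> in_ideal s f.
Proof.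
elim: s => [//|a s IHs]; rewrite inE => /predU1P[->|fs].
  by apply/in_ideal_cons; exists 1; rewrite mul1r subrr; case: (in_ideal_ideal s).
by apply/in_ideal_cons; exists 0; rewrite mul0r subr0; apply: IHs.
Qed.

Lemma in_ideal_rcons s a f : in_ideal (rcons s a) f <-> adjoin (in_ideal s) a f.
Proof.
elim: s f => [|b s IHs] f /=; first exact: in_ideal_cons.
split.
  move/in_ideal_cons=> [h /IHs[h' H]]; exists h'; apply/in_ideal_cons.
  by exists h; rewrite addrAC.
move=> [h /in_ideal_cons[h' H]]; apply/in_ideal_cons; exists h'; apply/IHs.
by exists h; rewrite addrAC.
Qed.

Lemma in_ideal_augment s f : all (@in_max_ideal K n) s -> in_ideal s f -> f@_0%MM = 0.
Proof.
move=> /allP s0 [c ->]; rewrite raddf_sum big1 // => k _ /=.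
rewrite rmorphM /=; have /eqP -> : in_max_ideal s`_k by apply/s0/mem_nth.
by rewrite mulr0.
Qed.

Lemma in_max_idealE f : in_max_ideal f -> exists g : 'I_n -> S, f = \sum_k g k * 'X_k.
Proof.
move/eqP=> f0.
pose Q f := exists g : 'I_n -> S, f = \sum_k g k * 'X_k.
rewrite -/(Q f) [f]mpolyE big_seq; elim/big_ind: _ => [|u v [g ->] [h ->]|m].
- by exists (fun=> 0); rewrite big1 // => k _; rewrite mul0r.
- exists (fun k => g k + h k).
  by rewrite -big_split; apply: eq_bigr => k _; rewrite mulrDl.
rewrite mcoeff_msupp => mf.
have : m != 0%MM by apply: contraNneq mf => ->; rewrite f0.
rewrite -mdeg_eq0 mdegE sum_nat_eq0 => /forallPn[k]; rewrite implyTb => mk.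
(* The whole term is assigned to one variable x_k that divides it. *)
exists (fun l => if l == k then f@_m *: 'X_[m - U_(k)] else 0).
rewrite (bigD1 k) //= eqxx big1 => [|l /negPf ->]; last by rewrite mul0r.
by rewrite addr0 -scalerAl -mpolyXD submK // lep1mP.
Qed.

Lemma mcoeffXM k f m :
  (f * 'X_k)@_m = if m k == 0%N then 0 else f@_(m - U_(k)).
Proof.
case: ifPn => [/eqP mk|mk]; last first.
  have mE : m = (U_(k) + (m - U_(k)))%MM by rewrite addmC submK // lep1mP.
  by rewrite {1}mE mcoeffMX.
apply/eqP; rewrite mcoeff_eq0; apply/negP; rewrite (perm_mem (msuppMX _ _)).
by case/mapP=> u _ uE; move: mk; rewrite uE mnmDE mnm1E eqxx.
Qed.

End Generated.

(** * The Koszul complex, its homotopies, and the bound on regular sequences *)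

Section Koszul.
Import Order.TTheory GRing.Theory.
Local Open Scope ring_scope.
Variables (K : fieldType) (n : nat).
Local Notation S := {mpoly K[n]}.
Local Notation chain := ({set 'I_n} -> S).
Implicit Types (f g h : S) (I : S -> Prop) (k l : 'I_n) (F G : {set 'I_n}) (b c e : chain).

(** For [k] outside [G], this is the sign with e_k /\ e_G = sign * e_(k |: G): e_k moves past the
    elements of [G] below [k]. *)
Definition koszul_sign k G : S := (-1) ^+ #|[set l in G | (l < k)%N]|.

(* e_k /\ c. *)
Definition exterior_mul k c : chain :=
  fun F => if k \in F then koszul_sign k (F :\ k) * c (F :\ k) else 0.

Lemma koszul_dE c G :
  koszul_d c G = \sum_(k | k \notin G) koszul_sign k G * 'X_k * c (k |: G).
Proof. by []. Qed.

Lemma koszul_sign_sq k G : koszul_sign k G * koszul_sign k G = 1.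
Proof. by rewrite -expr2 sqrr_sign. Qed.

Lemma koszul_signU1 k l G : l \notin G ->
  koszul_sign k (l |: G) = (-1) ^+ (l < k)%N * koszul_sign k G.
Proof.
move=> lG; rewrite /koszul_sign -exprD; congr (_ ^+ _).
case: ltnP => lk /=.
  have -> : [set x in l |: G | (x < k)%N] = l |: [set x in G | (x < k)%N].
    by apply/setP=> x; rewrite !inE; case: eqP => // ->; rewrite lk.
  by rewrite cardsU1 inE (negPf lG).
apply: eq_card => x; rewrite !inE; case: eqP => //= ->.
by rewrite ltnNge lk andbF.
Qed.

(** This is e_k /\ e_l = - e_l /\ e_k: exactly one of l < k and k < l holds, so exactly one side
    picks up an extra sign. *)
Lemma koszul_sign_swap k l G : k \notin G -> l \notin G -> l != k ->
  koszul_sign k G * koszul_sign l (k |: G) = - (koszul_sign l G * koszul_sign k (l |: G)).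
Proof.
move=> kG lG lk; rewrite !koszul_signU1 //.
have : (l : nat) != k by [].
by case: ltngtP => // _ _; rewrite ?expr0 ?expr1; ring.
Qed.

Lemma koszul_d_add b c G : koszul_d (fun F => b F + c F) G = koszul_d b G + koszul_d c G.
Proof. by rewrite !koszul_dE -big_split; apply: eq_bigr => k _; rewrite mulrDr. Qed.

Lemma koszul_d_scale f c G : koszul_d (fun F => f * c F) G = f * koszul_d c G.
Proof. by rewrite !koszul_dE mulr_sumr; apply: eq_bigr => k _; rewrite mulrCA. Qed.

Lemma koszul_d_ideal I c G : is_ideal I -> (forall F, I (c F)) -> I (koszul_d c G).
Proof. by move=> hI Ic; apply: ideal_sum => // k _; case: hI => _ _; apply. Qed.

(** The terms with l < k cancel those with k < l. Comparing the sum with its own transpose would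
    only show that twice the sum vanishes, which is too weak in characteristic 2. *)
Lemma sum_alternating (T : 'I_n -> 'I_n -> S) (p : pred 'I_n) :
    (forall k l, p k -> p l -> l != k -> T k l = - T l k) ->
  \sum_(k | p k) \sum_(l | p l && (l != k)) T k l = 0.
Proof.
move=> Talt.
under eq_bigr => k pk.
  rewrite (bigID (fun l : 'I_n => (l < k)%N)) /=; over.
rewrite big_split /= [X in _ + X](exchange_big_dep p) /=; last by move=> ? ? _ /andP[/andP[]].
rewrite -big_split big1 // => k pk /=.
rewrite (eq_bigl (fun l => p l && (l < k)%N)); last first.
  by move=> l; rewrite -andbA; congr (_ && _); rewrite andbC neq_ltn; case: ltngtP.
rewrite [X in _ + X](eq_bigl (fun l => p l && (l < k)%N)); last first.
  move=> l; rewrite pk /=; congr (_ && _); rewrite -leqNgt -val_eqE /= leq_eqVlt.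
  by rewrite eq_sym; case: ltngtP.
rewrite -big_split big1 // => l /andP[pl lk] /=.
by rewrite Talt ?subrr ?addNr // -val_eqE neq_ltn lk.
Qed.

Lemma koszul_dd c G : koszul_d (koszul_d c) G = 0.
Proof.
rewrite koszul_dE.
under eq_bigr => k kG.
  rewrite koszul_dE mulr_sumr.
  rewrite (eq_bigl (fun l => (l \notin G) && (l != k))); last first.
    by move=> l; rewrite !inE negb_or andbC.
  over.
apply: (sum_alternating (p := fun k => k \notin G)) => k l kG lG lk.
have -> : l |: (k |: G) = k |: (l |: G) by rewrite setUCA.
have H := koszul_sign_swap kG lG lk.
rewrite [LHS](_ : _ =
  (koszul_sign k G * koszul_sign l (k |: G)) * 'X_k * 'X_l * c (k |: (l |: G))); last by ring.
by rewrite H; ring.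
Qed.

Lemma koszul_homotopy k c G :
  koszul_d (exterior_mul k c) G + exterior_mul k (koszul_d c) G = 'X_k * c G.
Proof.
(* If [k] is not in [G], only the summand of index [k] in the differential survives, and its two
   equal signs multiply to 1. *)
rewrite {2}/exterior_mul koszul_dE; case: ifPn => kG; last first.
  rewrite addr0 (bigD1 k) //= big1 => [|l /andP[lG lk]]; last first.
    by rewrite /exterior_mul !inE eq_sym (negPf lk) (negPf kG) mulr0.
  rewrite /exterior_mul setU11 setU1K // addr0 -mulrA mulrCA.
  by rewrite [_ * (_ * c G)]mulrA koszul_sign_sq mul1r.
(* If [k] is in [G], the summand of index [k] in the differential at [G'] is the right-hand side;
   the others cancel, index by index, by [koszul_sign_swap]. *)
set G' := G :\ k; have kG' : k \notin G' by rewrite !inE eqxx.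
have GE : G = k |: G' by rewrite setD1K.
rewrite koszul_dE (bigD1 k kG') /= mulrDr addrCA -GE -mulrA mulrA koszul_sign_sq mul1r.
rewrite mulr_sumr (eq_bigl (fun l => (l \notin G') && (l != k))); last first.
  by move=> l; rewrite GE in_setU1 negb_or andbC.
rewrite -big_split big1 ?addr0 // => l /andP[lG' lk] /=.
have kl : k \in l |: G by rewrite setU1r.
rewrite /exterior_mul kl.
have -> : (l |: G) :\ k = l |: G'.
  by apply/setP=> x; rewrite !inE; case: eqP => // ->; rewrite eq_sym (negPf lk).
have H := koszul_sign_swap kG' lG' lk.
rewrite {1}GE.
rewrite [X in X + _](_ : _ =
  koszul_sign l (k |: G') * koszul_sign k (l |: G') * 'X_l * c (l |: G')); last by ring.
rewrite [X in _ + X](_ : _ =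
  (koszul_sign k G' * koszul_sign l G') * 'X_l * c (l |: G')); last by ring.
rewrite -!mulrDl.
have -> : koszul_sign l (k |: G') =
    - (koszul_sign k G' * (koszul_sign l G' * koszul_sign k (l |: G'))).
  by rewrite -mulrN -H mulrA koszul_sign_sq mul1r.
rewrite mulNr -!mulrA koszul_sign_sq mulr1 addNr.
by rewrite !mul0r.
Qed.

(** A representative in S of a nonzero class of H_p(x; S/I). The bounding chains that are excluded
    are arbitrary, so in particular graded ones are. *)
Definition koszul_class I p c :=
  [/\ forall F, #|F| != p -> c F = 0, forall G, I (koszul_d c G)
    & ~ exists b, forall F, I (c F - koszul_d b F)].

Lemma koszul_class_lt I p c : is_ideal I -> koszul_class I p c -> (p <= n)%N.
Proof.
move=> [I0 _ _] [csupp _ cnb]; rewrite leqNgt; apply/negP => np; apply: cnb.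
exists (fun=> 0) => F; rewrite koszul_dE big1 ?subr0 ?csupp //; last by move=> *; rewrite mulr0.
by rewrite neq_ltn (leq_ltn_trans (max_card _)) ?card_ord.
Qed.

(* The new class is sum g_k e_k /\ c, where f = sum g_k x_k. *)
Lemma koszul_class_adjoin I p c f : is_ideal I -> in_max_ideal f ->
    (forall g, I (g * f) -> I g) -> koszul_class I p c ->
  exists c', koszul_class (adjoin I f) p.+1 c'.
Proof.
move=> hI /in_max_idealE[g fE] freg [csupp cyc cnb].
case: (hI) => I0 ID IM.
pose h c' : chain := fun F => \sum_k g k * exterior_mul k c' F.
(* Combining the homotopies of the x_k with coefficients g_k gives d h + h d = f. *)
have dh c' G : koszul_d (h c') G + h (koszul_d c') G = f * c' G.
  have -> : koszul_d (h c') G = \sum_k g k * koszul_d (exterior_mul k c') G.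
    under [RHS]eq_bigr do rewrite koszul_dE mulr_sumr.
    rewrite koszul_dE exchange_big /=; apply: eq_bigr => l _.
    by rewrite mulr_sumr; apply: eq_bigr => k _; rewrite mulrCA.
  rewrite -big_split fE mulr_suml; apply: eq_bigr => k _ /=.
  by rewrite -mulrDr koszul_homotopy mulrA.
have Ih G : I (h (koszul_d c) G).
  apply: ideal_sum => // k _; apply: (IM); rewrite /exterior_mul.
  by case: ifP => // _; apply: (IM).
exists (h c); split.
- move=> F Fp; rewrite /h big1 // => k _; rewrite /exterior_mul.
  case: ifPn => kF; last by rewrite mulr0.
  by rewrite csupp ?mulr0 //; move: Fp; rewrite (cardsD1 k) kF eqSS.
- move=> G; exists (c G); rewrite [c G * f]mulrC -dh.
  by have := IM (-1) _ (Ih G); congr I; ring.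
(* Suppose h c = d b' + f e modulo I. Applying d gives d (h c) = f d e, while d (h c) = f c modulo I
   since c is a cycle; hence f (c - d e) lies in I, and regularity of f makes c a boundary. *)
case=> b' Hb'; have [e He] := fin_all_exists Hb'; apply: cnb; exists e => G; apply: freg.
have := koszul_d_ideal G hI He.
rewrite (_ : koszul_d _ G = koszul_d (h c) G - f * koszul_d e G); last first.
  transitivity (koszul_d (fun F => h c F + ((-1) * koszul_d b' F + (- f) * e F)) G).
    by apply: eq_bigr => k _; congr (_ * _); ring.
  by rewrite koszul_d_add koszul_d_add !koszul_d_scale koszul_dd; ring.
move=> H; have := ID _ _ H (Ih G); congr I.
by rewrite addrAC dh; ring.
Qed.

(** Each element of [fs] raises the homological degree of a surviving class by one, and this degree
    cannot exceed n. *)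
Lemma regular_seq_size (s fs : seq S) (p : nat) (c : chain) :
  koszul_class (in_ideal s) p c -> regular_seq s fs -> (p + size fs <= n)%N.
Proof.
move=> Hc [/allP fs0 [freg _]].
suff H (k : nat) : (k <= size fs)%N ->
    exists c, koszul_class (in_ideal (s ++ take k fs)) (p + k)%N c.
  have [c' Hc'] := H (size fs) (leqnn _).
  by apply: koszul_class_lt Hc'; apply: in_ideal_ideal.
elim: k => [|k IHk] ks; first by exists c; rewrite take0 cats0 addn0.
have [c1 Hc1] := IHk (ltnW ks).
have [c' [c'supp c'cyc c'nb]] := 
  @koszul_class_adjoin _ _ _ fs`_k (in_ideal_ideal (s ++ take k fs))
    (fs0 _ (mem_nth 0 ks)) (freg k ks) Hc1.
exists c'; rewrite addnS (take_nth 0 ks) -rcons_cat; split=> //.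
  by move=> G; apply/in_ideal_rcons.
by case=> b Hb; apply: c'nb; exists b => F; apply/in_ideal_rcons.
Qed.

End Koszul.

(** * Monomial ideals as upward closed sets of exponents *)

Section MonomialIdeals.
Import Order.TTheory GRing.Theory.
Local Open Scope ring_scope.
Variables (K : fieldType) (n : nat).
Local Notation S := {mpoly K[n]}.
Implicit Types (f g h : S) (m u : 'X_{1..n}) (P Q : pred 'X_{1..n}) (k : 'I_n).

(* A monomial ideal is represented by the upward closed set P of the exponents
   of its monomials; the colon ideal by x_k is then m |-> P (m + U_k). *)
Definition monomial_ideal P f := forall m, f@_m != 0 -> P m.

Definition up_closed P := forall m u, P m -> P (m + u)%MM.

Lemma monomial_ideal_ideal P : up_closed P -> is_ideal (monomial_ideal P).
Proof.
move=> up; split.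
- by move=> m; rewrite mcoeff0 eqxx.
- move=> f g Pf Pg m; rewrite mcoeffD; have [f0|/Pf //] := eqVneq f@_m 0.
  by rewrite f0 add0r; apply: Pg.
move=> h f Pf m; rewrite -mcoeff_msupp => /msuppM_le/allpairsP[[u v] /= [_ vf ->]].
by rewrite addmC; apply/up/Pf; rewrite -mcoeff_msupp.
Qed.

Lemma monomial_idealX P m : P m -> monomial_ideal P 'X_[m].
Proof. by move=> Pm u; rewrite mcoeffX; case: (m =P u) => [<-|]; rewrite ?eqxx. Qed.

Lemma monomial_idealXM P k f :
  monomial_ideal P (f * 'X_k) <-> monomial_ideal (fun m => P (m + U_(k))%MM) f.
Proof.
split=> Pf m fm.
  by apply: Pf; rewrite mcoeffXM mnmDE mnm1E eqxx addn1 addmK.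
move: fm; rewrite mcoeffXM; case: ifPn => [_|mk /Pf]; first by rewrite eqxx.
by rewrite submK // lep1mP.
Qed.

(** For the converse, f is the sum of its terms and each of them is a multiple of a generator. *)
Lemma in_ideal_monomial (ms : seq 'X_{1..n}) f :
  in_ideal [seq 'X_[u] | u <- ms] f <->
  monomial_ideal (fun m => has (fun u => (u <= m)%MM) ms) f.
Proof.
set P : pred 'X_{1..n} := fun m => has _ _.
have upP : up_closed P.
  move=> m u /hasP[v vms vm]; apply/hasP; exists v => //.
  exact: lepm_trans vm (lem_addr _ _).
have [I0 ID IM] := in_ideal_ideal [seq 'X_[K, u] | u <- ms].
have [J0 JD JM] := monomial_ideal_ideal upP.
split.
  case=> c ->; apply: ideal_sum; first exact: monomial_ideal_ideal.
  move=> k _; apply: (JM); have : (k < size ms)%N by rewrite -(size_map (fun u => 'X_[K, u])).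
  move=> kms; rewrite (nth_map 0%MM) //; apply: monomial_idealX.
  by apply/hasP; exists (nth 0%MM ms k); rewrite ?mem_nth ?lepm_refl.
move=> Pf; rewrite [f]mpolyE big_seq; apply: ideal_sum; first exact: in_ideal_ideal.
move=> m; rewrite mcoeff_msupp => /Pf/hasP[u ums um].
rewrite -(submK um) mpolyXD scalerAl; apply: (IM).
by apply/in_ideal_mem/map_f.
Qed.

Definition select P f : S := \sum_(m <- msupp f | P m) f@_m *: 'X_[m].

Lemma mcoeff_select P f m : (select P f)@_m = if P m then f@_m else 0.
Proof.
rewrite raddf_sum /=; under eq_bigr do rewrite mcoeffZ mcoeffX.
case: ifPn => Pm; last first.
  by rewrite big1 // => u Pu; case: (u =P m) Pu => [->|]; rewrite ?(negPf Pm) ?mulr0.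
have [mf|mf] := boolP (m \in msupp f); last first.
  rewrite big_seq_cond big1 => [|u /andP[uf _]]; last first.
    by case: (u =P m) uf mf => [-> -> //|]; rewrite mulr0.
  by apply/esym/eqP; rewrite mcoeff_eq0.
rewrite -big_filter (bigD1_seq m) ?filter_uniq ?msupp_uniq ?mem_filter ?Pm //=.
by rewrite eqxx mulr1 big1 ?addr0 // => u /negPf ->; rewrite mulr0.
Qed.

(** Disjunction of predicates is the sum of ideals: the terms of f with exponent in [P] form the
    first summand. *)
Lemma monomial_ideal_or P Q f : monomial_ideal (fun m => P m || Q m) f ->
  exists2 g, monomial_ideal P g & monomial_ideal Q (f - g).
Proof.
move=> PQf; exists (select P f) => m; rewrite ?mcoeffB mcoeff_select.
  by case: ifP; rewrite ?eqxx.
case: ifPn => Pm; first by rewrite subrr eqxx.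
by rewrite subr0 => /PQf; rewrite (negPf Pm).
Qed.

(** The quotient of f by x_k. Terms free of x_k have to be filtered out, because subtraction of
    exponents truncates and would keep them. *)
Definition div_var k f : S := \sum_(m <- msupp f | m k != 0%N) f@_m *: 'X_[m - U_(k)].

Lemma mcoeff_div_var k f m : (div_var k f)@_m = f@_(m + U_(k)).
Proof.
(* This makes both sides sums over the same filtered support. *)
have -> : f@_(m + U_(k)) = (select (fun u => u k != 0%N) f)@_(m + U_(k)).
  by rewrite mcoeff_select mnmDE mnm1E eqxx addn1.
rewrite !raddf_sum /=; apply: eq_bigr => u uk.
rewrite !mcoeffZ !mcoeffX; congr (_ * _); congr (_%:R).
by rewrite -[u in RHS](@submK _ U_(k) u) ?lep1mP // eqm_add2r.
Qed.

Lemma div_var0 k : div_var k 0 = 0.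
Proof. by apply/mpolyP => m; rewrite mcoeff_div_var !mcoeff0. Qed.

Lemma div_var_dhomog k d f : f \is d.+1.-homog -> div_var k f \is d.-homog.
Proof.
move/dhomogP=> fd; apply/dhomogP => m; rewrite mcoeff_msupp mcoeff_div_var -mcoeff_msupp.
by move/fd => /=; rewrite mdegD mdeg1 addn1 => -[].
Qed.

Lemma div_var0_dhomog k f : f \is 0.-homog -> div_var k f = 0.
Proof.
move/dhomogP=> fd; apply/mpolyP => m; rewrite mcoeff_div_var mcoeff0; apply/eqP.
by rewrite mcoeff_eq0; apply/negP => /fd /=; rewrite mdegD mdeg1 addn1.
Qed.

Lemma monomial_ideal_div_var P k f :
  monomial_ideal (fun m => P m || (0 < m k)%N) f ->
  monomial_ideal P (f - div_var k f * 'X_k).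
Proof.
move=> Pf m; rewrite mcoeffB mcoeffXM; case: ifPn => mk.
  by rewrite subr0 => /Pf; rewrite (eqP mk) orbF.
by rewrite mcoeff_div_var submK ?lep1mP // subrr eqxx.
Qed.

End MonomialIdeals.

(** * Vanishing of Koszul homology in large internal degree *)

Section Regularity.
Import Order.TTheory GRing.Theory.
Local Open Scope ring_scope.
Variables (K : fieldType) (n : nat).
Local Notation S := {mpoly K[n]}.
Local Notation chain := ({set 'I_n} -> S).
Implicit Types (f g h : S) (m u : 'X_{1..n}) (P Q R : pred 'X_{1..n}) (k : 'I_n) (F G : {set 'I_n}).

(* Homogeneity of degree d - 1; for d = 0 only the zero polynomial qualifies. *)
Definition pred_homog d f := if d is d'.+1 then f \is d'.-homog else f == 0.

(* H_i(x; S/I)_{i+d} = 0 for all i, where I is the monomial ideal of P. *)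
Definition koszul_vanish P d := forall i (c : chain),
    (forall F, #|F| != i -> c F = 0) -> (forall F, c F \is d.-homog) ->
    (forall G, monomial_ideal P (koszul_d c G)) ->
  exists b : chain, [/\ forall F, #|F| != i.+1 -> b F = 0,
    forall F, pred_homog d (b F) & forall F, monomial_ideal P (c F - koszul_d b F)].

Lemma eq_koszul_vanish P Q d : P =1 Q -> koszul_vanish P d -> koszul_vanish Q d.
Proof.
move=> PQ V i c c1 c2 c3; case: (V i c c1 c2) => [G m /c3|b [b1 b2 b3]]; first by rewrite PQ.
by exists b; split=> // F m /b3; rewrite PQ.
Qed.

Lemma koszul_vanish_full P d : (forall f, f \is d.-homog -> monomial_ideal P f) ->
  koszul_vanish P d.
Proof.
move=> Pd i c c1 c2 c3; exists (fun=> 0); split=> // [F|F].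
  by case: (d) => [|d'] /=; rewrite ?eqxx ?rpred0.
rewrite koszul_dE big1 => [|k _]; last by rewrite mulr0.
by rewrite subr0; apply: Pd.
Qed.

Lemma koszul_vanish_unit P d : (forall m, P m) -> koszul_vanish P d.
Proof. by move=> P1; apply: koszul_vanish_full => f _ m _; apply: P1. Qed.

Lemma pred_homog_div_var d k f : f \is d.-homog -> pred_homog d (div_var k f).
Proof.
case: d => [|d] fd /=; first by rewrite div_var0_dhomog.
exact: div_var_dhomog.
Qed.

Lemma pred_homogXM d f k : pred_homog d f -> f * 'X_k \is d.-homog.
Proof.
case: d => [/eqP->|d fd]; first by rewrite mul0r rpred0.
by rewrite -addn1; apply: dhomogM => //; rewrite dhomogX /= mdeg1.
Qed.

Lemma koszul_d_dhomog d (b : chain) G :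
  (forall F, pred_homog d (b F)) -> koszul_d b G \is d.-homog.
Proof.
move=> bd; rewrite koszul_dE; apply: rpred_sum => k _; rewrite -mulrA.
rewrite -[koszul_sign _ _ _]/((-1) ^+ _) -signr_odd mulr_sign ['X_k * _]mulrC.
by case: ifP => _; rewrite ?rpredN; apply: pred_homogXM.
Qed.

(** The common start of the two reductions below: c bounds modulo I + (x_k), and the defect c - d b,
    divided by x_k, is a cycle e modulo I : x_k of degree one less. *)
Lemma koszul_lift P k d i (c : chain) : up_closed P ->
    koszul_vanish (fun m => P m || (0 < m k)%N) d ->
    (forall F, #|F| != i -> c F = 0) -> (forall F, c F \is d.-homog) ->
    (forall G, monomial_ideal P (koszul_d c G)) ->
  exists b e : chain,
    [/\ forall F, #|F| != i.+1 -> b F = 0, forall F, pred_homog d (b F),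
        forall F, #|F| != i -> e F = 0, forall F, pred_homog d (e F)
      & (forall F, monomial_ideal P (c F - koszul_d b F - e F * 'X_k)) /\
        (forall G, monomial_ideal (fun m => P (m + U_(k))%MM) (koszul_d e G))].
Proof.
move=> upP V c1 c2 c3.
have [|b [b1 b2 b3]] := V i c c1 c2; first by move=> G m /c3 ->.
have [J0 JD JM] := monomial_ideal_ideal K upP.
exists b, (fun F => div_var k (c F - koszul_d b F)).
have H F : monomial_ideal P (c F - koszul_d b F - div_var k (c F - koszul_d b F) * 'X_k).
  exact: monomial_ideal_div_var.
split=> //; last split=> // G.
- move=> F Fi; rewrite c1 // koszul_dE big1 ?subrr ?div_var0 // => l lF.
  by rewrite b1 ?mulr0 // cardsU1 lF eqSS.
- by move=> F; apply: pred_homog_div_var; apply: rpredB; [exact: c2|exact: koszul_d_dhomog].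
(* Modulo I, x_k e = c - d b, so x_k d e = d c, which is in I. *)
apply/monomial_idealXM; rewrite mulrC -koszul_d_scale.
have := koszul_d_ideal G (monomial_ideal_ideal K upP) H.
rewrite (_ : koszul_d _ G = koszul_d c G -
  koszul_d (fun F => 'X_k * div_var k (c F - koszul_d b F)) G); last first.
  transitivity (koszul_d (fun F => c F + ((-1) * koszul_d b F +
      (-1) * ('X_k * div_var k (c F - koszul_d b F)))) G).
    by apply: eq_bigr => l _; congr (_ * _); ring.
  by rewrite !koszul_d_add !koszul_d_scale koszul_dd; ring.
move=> H1; have := idealB (monomial_ideal_ideal K upP) (c3 G) H1.
by congr monomial_ideal; ring.
Qed.

(** If e = d b' modulo I : x_k, then x_k e = d (x_k b') modulo I, so c is the boundary of b + x_k
    b'. *)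
Lemma koszul_vanish_colon P k d : up_closed P -> (0 < d)%N ->
    koszul_vanish (fun m => P m || (0 < m k)%N) d ->
    koszul_vanish (fun m => P (m + U_(k))%MM) d.-1 ->
  koszul_vanish P d.
Proof.
case: d => [//|d] upP _ V1 V2 i c c1 c2 c3.
have [b [e [b1 b2 e1 e2 [be ecyc]]]] := koszul_lift upP V1 c1 c2 c3.
have [b' [b'1 b'2 b'3]] := V2 i e e1 e2 ecyc.
exists (fun F => b F + 'X_k * b' F); split=> F.
- by move=> Fi; rewrite b1 // b'1 // mulr0 addr0.
- by apply: rpredD; [exact: b2|rewrite mulrC; exact: pred_homogXM].
have [J0 JD JM] := monomial_ideal_ideal K upP.
have := JD _ _ (be F) (proj2 (monomial_idealXM P k _) (b'3 F)).
by rewrite koszul_d_add koszul_d_scale; congr monomial_ideal; ring.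
Qed.

(** Here I : x_k = I, so e is a cycle modulo I and [koszul_homotopy] turns x_k e into the boundary
    of e_k /\ e. *)
Lemma koszul_vanish_regular P k d : up_closed P -> (0 < d)%N ->
    (forall m, P (m + U_(k))%MM = P m) ->
    koszul_vanish (fun m => P m || (0 < m k)%N) d ->
  koszul_vanish P d.
Proof.
case: d => [//|d] upP _ Pk V1 i c c1 c2 c3.
have [b [e [b1 b2 e1 e2 [be ecyc]]]] := koszul_lift upP V1 c1 c2 c3.
exists (fun F => b F + exterior_mul k e F); split=> F.
- move=> Fi; rewrite b1 // add0r /exterior_mul; case: ifP => // kF.
  by rewrite e1 ?mulr0 //; move: Fi; rewrite (cardsD1 k) kF eqSS.
- apply: rpredD; first exact: b2.
  rewrite /exterior_mul; case: ifP => _; last exact: rpred0.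
  rewrite -[koszul_sign _ _ _]/((-1) ^+ _) -signr_odd mulr_sign.
  by case: ifP => _; rewrite ?rpredN; apply: e2.
have [J0 JD JM] := monomial_ideal_ideal K upP.
have Pe : monomial_ideal P (exterior_mul k (koszul_d e) F).
  rewrite /exterior_mul; case: ifP => // _; apply: (JM) => m /ecyc.
  by rewrite Pk.
have := JD _ _ (be F) Pe; rewrite koszul_d_add.
have := koszul_homotopy k e F; rewrite mulrC => <-.
by congr monomial_ideal; ring.
Qed.

(** Either x_k lies in the ideal or it is a nonzerodivisor modulo it. For an upward closed [P],
    having this for all k means that the ideal is generated by variables or is the whole ring. *)
Definition linear_in P k :=
  (forall m, P (m + U_(k))%MM) \/ (forall m, P (m + U_(k))%MM = P m).

Lemma koszul_vanish_linear P d : up_closed P -> (0 < d)%N ->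
  (forall k, linear_in P k) -> koszul_vanish P d.
Proof.
move=> upP d0 lin.
pose Ps (s : seq 'I_n) m := P m || has (fun k => (0 < m k)%N) s.
have upPs s : up_closed (Ps s).
  move=> m u /orP[/upP Pm|/hasP[k ks mk]]; apply/orP; [by left|right].
  by apply/hasP; exists k; rewrite // mnmDE ltn_addr.
(* The list [t] holds the variables already adjoined and [s] those still to come. Once all are
   adjoined, every form of positive degree lies in the ideal; each removal is then trivial or
   removes a regular variable. *)
suff H s t : perm_eq (s ++ t) (enum 'I_n) -> koszul_vanish (Ps t) d.
  by apply: eq_koszul_vanish (H (enum 'I_n) [::] _) => [m|]; rewrite ?cats0 // /Ps orbF.
elim: s t => [|k s IHs] t st.
  apply: koszul_vanish_full => f /dhomogP fd m fm.
  have /fd md : m \in msupp f by rewrite mcoeff_msupp.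
  apply/orP; right; apply/hasP; move: d0; rewrite -md /= lt0n mdegE sum_nat_eq0.
  case/forallPn => k; rewrite implyTb -lt0n => mk; exists k => //.
  by rewrite (perm_mem st) mem_enum.
have V : koszul_vanish (Ps (k :: t)) d.
  by apply: IHs; rewrite (perm_trans _ st) // -(cat1s k) perm_catCA.
case: (lin k) => Pk.
  apply: eq_koszul_vanish V => m; rewrite /Ps /=.
  have [->|mk] := eqVneq (m k) 0%N; first by rewrite ltnn.
  by rewrite -(@submK _ U_(k) m) ?Pk // lep1mP.
apply: (koszul_vanish_regular (k := k)) => // [m|].
  rewrite /Ps Pk; congr (_ || _); apply: eq_in_has => l lt.
  rewrite mnmDE mnm1E; case: eqP => [kl|]; last by rewrite addn0.
  have := perm_uniq st; rewrite enum_uniq /= mem_cat kl lt orbT.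
  by [].
by apply: eq_koszul_vanish V => m; rewrite /Ps /= orbCA orbC.
Qed.

(* The ideal (x_i^a x_j^b) + L with L generated by variables other than x_i, x_j. *)
Lemma koszul_vanish_pair R (i j : 'I_n) a b d : i != j -> up_closed R ->
    (forall k, linear_in R k) -> (forall m, R (m + U_(i))%MM = R m) ->
    (forall m, R (m + U_(j))%MM = R m) -> (a + b <= d)%N ->
  koszul_vanish (fun m => [&& (a <= m i)%N & (b <= m j)%N] || R m) d.
Proof.
move=> ij upR lin; move abE: (a + b)%N => ab.
elim: ab i j ij a b d abE => [|ab IH] i j ij a b d.
  by move/eqP; rewrite addn_eq0 => /andP[/eqP-> /eqP->] *; apply: koszul_vanish_unit.
(* Since a + b is positive, exchanging the two variables makes a positive. *)
wlog a0 : i j ij a b / (0 < a)%N => [W|] abE Ri Rj abd.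
  case: a abE => [|a] abE; last by apply: W.
  rewrite add0n in abE.
  apply: (@eq_koszul_vanish (fun m => [&& (b <= m j)%N & (0 <= m i)%N] || R m)).
    by move=> m; rewrite andbC.
  by apply: W; rewrite ?abE ?addn0 // eq_sym.
have upP : up_closed (fun m => [&& (a <= m i)%N & (b <= m j)%N] || R m).
  move=> m u /orP[/andP[am bm]|/upR ->]; last by rewrite orbT.
  by rewrite !mnmDE !(leq_trans _ (leq_addr _ _)).
have d0 : (0 < d)%N by apply: leq_trans abd.
(* Modulo x_i only L + (x_i) remains, because a > 0. The colon by x_i lowers a by one, in step with
   the degree. *)
apply: (koszul_vanish_colon (k := i)) => //.
  apply: (@eq_koszul_vanish (fun m => R m || (0 < m i)%N)) => [m|].
    by case: (R m) => /=; rewrite ?orbT // orbF; lia.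
  apply: koszul_vanish_linear => // [m u|k].
    by case/orP => [/upR-> //|mi]; rewrite mnmDE ltn_addr ?orbT.
  have [->|ki] := eqVneq i k.
    by left => m; rewrite mnmDE mnm1E eqxx addn1 orbT.
  case: (lin k) => Rk; [left|right] => m; first by rewrite Rk.
  by rewrite Rk mnmDE mnm1E eq_sym (negPf ki) addn0.
apply: (@eq_koszul_vanish (fun m => [&& (a.-1 <= m i)%N & (b <= m j)%N] || R m)) => [m|].
  by rewrite Ri !mnmDE !mnm1E eqxx (negPf ij); lia.
by apply: IH => //; lia.
Qed.

End Regularity.

(** * Explicit nonzero Koszul classes and the regularity they detect *)

Section KoszulWitness.
Import Order.TTheory GRing.Theory.
Local Open Scope ring_scope.
Variables (K : fieldType) (n : nat).
Local Notation S := {mpoly K[n]}.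
Local Notation chain := ({set 'I_n} -> S).
Implicit Types (f g h : S) (m u : 'X_{1..n}) (P : pred 'X_{1..n}).
Implicit Types (i j k : 'I_n) (F G B : {set 'I_n}).

(** No summand other than that of x_j reaches the exponent m + U_j, since the other variables
    outside [G] do not divide this monomial. *)
Lemma mcoeff_koszul_d j G m (b : chain) : j \notin G ->
    (forall k, k \notin G -> k != j -> m k = 0%N) ->
  (koszul_d b G)@_(m + U_(j)) = (-1) ^+ #|[set l in G | (l < j)%N]| * (b (j |: G))@_m.
Proof.
move=> jG m0; rewrite raddf_sum /= (bigD1 j jG) /= big1 ?addr0 => [|k /andP[kG kj]].
  rewrite mulrAC mcoeffXM mnmDE mnm1E eqxx addn1 /= addmK.
  by rewrite -signr_odd mulr_sign -[in RHS]signr_odd mulr_sign; case: ifP; rewrite ?mcoeffN.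
by rewrite mulrAC mcoeffXM mnmDE mnm1E m0 // [j == k]eq_sym (negPf kj).
Qed.

Definition monomial_chain B m : chain := fun F => if F == B then 'X_[m] else 0.

(* A single monomial chain at i |: B fails to be a boundary because bounding it
   forces the nonzero coefficient to reappear at j |: B. *)
Lemma koszul_class_monomial P i j B m : up_closed P -> i != j -> i \notin B -> j \notin B ->
    (forall k, k != i -> k != j -> m k = 0%N) ->
    ~~ P (m + U_(j))%MM -> ~~ P (m + U_(i))%MM ->
    (forall k, k \in i |: B -> P (m + U_(j) + U_(k))%MM) ->
  koszul_class (monomial_ideal (K := K) P) #|B|.+1 (monomial_chain (i |: B) (m + U_(j))).
Proof.
move=> upP ij iB jB m0 Pj Pi PB; rewrite /monomial_chain.
have hI := monomial_ideal_ideal K upP; case: (hI) => J0 JD JM.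
have ji : j != i by rewrite eq_sym.
have jiB : j \notin i |: B by rewrite !inE negb_or ji.
have ijB : i \notin j |: B by rewrite !inE negb_or ij.
split.
- by move=> F; case: (F =P _) => // ->; rewrite cardsU1 iB eqxx.
- move=> G; apply: ideal_sum => // k kG; rewrite -mulrA; apply: (JM).
  case: eqP => [kGE|]; last by rewrite mulr0.
  rewrite mulrC; apply/monomial_idealXM => u; rewrite mcoeffX.
  case: (_ =P u) => [<- _|]; last by rewrite eqxx.
  by apply: PB; rewrite -kGE setU11.
case=> b Hb.
have bm : (b (j |: (i |: B)))@_m = 0.
  have := contraNF (Hb (j |: B) (m + U_(i))%MM) Pi.
  rewrite mcoeffB mcoeff_koszul_d // => [|k]; last first.
    by rewrite !inE negb_or => /andP[kj _] ki; apply: m0.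
  case: (_ =P i |: B) => [E|_]; first by move: ijB; rewrite E setU11.
  rewrite mcoeff0 sub0r oppr_eq0 mulf_eq0 signr_eq0 /= => /negbFE/eqP.
  by rewrite setUCA.
have := contraNF (Hb (i |: B) (m + U_(j))%MM) Pj.
rewrite mcoeffB mcoeff_koszul_d // => [|k]; last first.
  by rewrite !inE negb_or => /andP[ki _] kj; apply: m0.
by rewrite bm mulr0 subr0 eqxx mcoeffX eqxx oner_eq0.
Qed.

Lemma monomial_chain_dhomog B m F : monomial_chain B m F \is (mdeg m).-homog.
Proof. by rewrite /monomial_chain; case: eqP => _; rewrite ?rpred0 // dhomogX /=. Qed.

(** The class sits in internal degree p + d and gives the lower bound; the vanishing for d' > d
    gives the upper one. *)
Lemma reg_eq_monomial s P p d (c : chain) :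
    (forall f, in_ideal s f <-> monomial_ideal P f) ->
    koszul_class (monomial_ideal P) p c -> (forall F, c F \is d.-homog) ->
    (forall d', (d < d')%N -> koszul_vanish K P d') ->
  reg_eq s d.
Proof.
move=> sP [c1 c2 c3] cd V; split.
  exists p, (p + d)%N; split=> //; split; first exact: leq_addr.
  exists c; rewrite addKn; split=> // [G|]; first by apply/sP; apply: c2.
  by case=> b [_ _ _ Hb]; apply: c3; exists b => F; apply/sP; apply: Hb.
move=> i j [ij [e [e1 e2 e3 e4]]]; rewrite leqNgt; apply/negP => dj; apply: e4.
have dij : (d < j - i)%N by rewrite ltn_subRL.
have [|b [b1 b2 b3]] := V _ dij i e e1 e2.
  by move=> G; apply/sP; apply: e3.
exists b; split=> //; last by move=> F; apply/sP; apply: b3.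
(* In positive degree [pred_homog] is homogeneity of the predecessor degree, as [tor_nz]
   requires. *)
- have : (0 < j - i)%N by lia.
  by case: (j - i)%N b2.
- by left; lia.
Qed.

End KoszulWitness.

(** * Nonzerodivisors modulo monomial ideals, and regular sequences of length at most two *)

Section NonZeroDivisors.
Import Order.TTheory GRing.Theory.
Local Open Scope ring_scope.
Variables (K : fieldType) (n : nat).
Local Notation S := {mpoly K[n]}.
Implicit Types (f g h : S) (m u : 'X_{1..n}) (P Q R A B : pred 'X_{1..n}) (i j k : 'I_n).

Definition nzd P f := forall g, monomial_ideal P (g * f) -> monomial_ideal P g.

Lemma eq_nzd P Q f : P =1 Q -> nzd P f -> nzd Q f.
Proof. by move=> PQ Pf g Qg m; rewrite -PQ; apply: Pf => u /Qg; rewrite PQ. Qed.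

Lemma nzd_var P k : (forall m, P (m + U_(k))%MM = P m) -> nzd P 'X_k.
Proof. by move=> Pk g /monomial_idealXM Pg m /Pg; rewrite Pk. Qed.

Lemma nzd_mul P f h : nzd P f -> nzd P h -> nzd P (f * h).
Proof. by move=> Pf Ph g; rewrite mulrA => /Ph/Pf. Qed.

(** Conjunction is the intersection of ideals, so a decomposition can be checked one component at a
    time. *)
Lemma nzd_and P Q f : nzd P f -> nzd Q f -> nzd (fun m => P m && Q m) f.
Proof.
by move=> Pf Qf g PQg m gm; rewrite (Pf g) ?(Qf g) // => u /PQg/andP[].
Qed.

(** Here x_k is nilpotent modulo I. From g (f + x_k) in I, membership of g x_k^(e+1) gives that of f
    g x_k^e, hence of g x_k^e; descend from e + 1 = N. *)
Lemma nzd_add_nilpotent P f k N : up_closed P -> nzd P f ->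
  (forall m, (N <= m k)%N -> P m) -> nzd P (f + 'X_k).
Proof.
move=> upP Pf PN g Pg.
have hI := monomial_ideal_ideal K upP; case: (hI) => J0 JD JM.
suff H M : (M <= N)%N -> monomial_ideal P (g * 'X_k ^+ (N - M)).
  by have := H N (leqnn _); rewrite subnn expr0 mulr1.
elim: M => [_|M IHM MN].
  rewrite subn0 mpolyXn; apply: (JM) => m; rewrite mcoeffX.
  case: (_ =P m) => [<- _|]; last by rewrite eqxx.
  by apply: PN; rewrite mulmnE mnm1E eqxx mul1n.
apply: Pf; have := idealB hI (JM ('X_k ^+ (N - M.+1)) _ Pg) (IHM (ltnW MN)).
rewrite (_ : (N - M)%N = (N - M.+1).+1); last by lia.
by rewrite exprS; congr monomial_ideal; ring.
Qed.

(* With P = A /\ B, a relation of f1, f2 on A and on B lifts to P as soon as f1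
   is a nonzerodivisor on A \/ B; this is the depth lemma for
   0 -> S/P -> S/A + S/B -> S/(A + B) -> 0. *)
Lemma relation_and A B f1 f2 : up_closed A -> up_closed B ->
    nzd (fun m => A m || B m) f1 ->
    (forall g, adjoin (monomial_ideal A) f1 (g * f2) -> adjoin (monomial_ideal A) f1 g) ->
    (forall g, adjoin (monomial_ideal B) f1 (g * f2) -> adjoin (monomial_ideal B) f1 g) ->
  forall g, adjoin (monomial_ideal (fun m => A m && B m)) f1 (g * f2) ->
    adjoin (monomial_ideal (fun m => A m && B m)) f1 g.
Proof.
move=> upA upB fAB HA HB g [h Ph].
have [|a Ha] := HA g; first by exists h => m /Ph/andP[].
have [|b Hb] := HB g; first by exists h => m /Ph/andP[].
have hA := monomial_ideal_ideal K upA; have hB := monomial_ideal_ideal K upB.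
have upAB : up_closed (fun m => A m || B m).
  by move=> m u /orP[/upA->|/upB->]; rewrite ?orbT.
have hAB := monomial_ideal_ideal K upAB.
have Hab : monomial_ideal (fun m => A m || B m) ((a - b) * f1).
  rewrite (_ : _ * _ = (g - b * f1) - (g - a * f1)); last by ring.
  by apply: (idealB hAB) => m; [move/Hb->; rewrite orbT | move/Ha->].
(* Write a - b as [al] in A plus a remainder in B; then a - al is a coefficient of f1 that works
   modulo both ideals. *)
have [al Aal Bal] := monomial_ideal_or (fAB _ Hab).
exists (a - al) => m gm; apply/andP; split.
  move: m gm; case: hA => _ AD AM.
  by have := AD _ _ Ha (AM f1 _ Aal); congr monomial_ideal; ring.
move: m gm; case: hB => _ BD BM.
by have := idealB (monomial_ideal_ideal K upB) Hb (BM f1 _ Bal); congr monomial_ideal; ring.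
Qed.

(** Exchange in a regular sequence: if g x_k = h f1 modulo A, then h f1 is in A + (x_k), so h = h'
    x_k modulo A, and x_k cancels from x_k (g - h' f1). *)
Lemma relation_swap A f1 k : up_closed A -> nzd (fun m => A m || (0 < m k)%N) f1 ->
    nzd A 'X_k ->
  forall g, adjoin (monomial_ideal A) f1 (g * 'X_k) -> adjoin (monomial_ideal A) f1 g.
Proof.
move=> upA f1A kA g [h Hh].
have hA := monomial_ideal_ideal K upA; case: (hA) => A0 AD AM.
set A' := fun m => _ in f1A.
have upA' : up_closed A'.
  by move=> m u /orP[/upA Am|mk]; apply/orP; [left|right; rewrite mnmDE ltn_addr].
have hA' := monomial_ideal_ideal K upA'; case: (hA') => A'0 A'D A'M.
have A'h : monomial_ideal A' h.
  apply: f1A; rewrite (_ : h * f1 = g * 'X_k - (g * 'X_k - h * f1)); last by ring.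
  apply: (idealB hA') => [|m /Hh Am]; last by rewrite /A' Am.
  apply: A'M => m; rewrite mcoeffX; case: (_ =P m) => [<- _|]; last by rewrite eqxx.
  by rewrite /A' mnm1E eqxx orbT.
have Ah := monomial_ideal_div_var A'h.
exists (div_var k h); apply: kA.
by have := AD _ _ Hh (AM f1 _ Ah); congr monomial_ideal; ring.
Qed.

(** B + (x_k) is again a monomial ideal, so the relation is plain regularity of f2 modulo it. *)
Lemma relation_monomial B f2 k : up_closed B -> nzd (fun m => B m || (0 < m k)%N) f2 ->
  forall g, adjoin (monomial_ideal B) 'X_k (g * f2) -> adjoin (monomial_ideal B) 'X_k g.
Proof.
move=> upB f2B g [h Hh]; exists (div_var k g).
apply: monomial_ideal_div_var; apply: f2B => m /=.
have [//|/norP[/negPf Bm mk]] := boolP (B m || (0 < m k)%N).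
rewrite -[g * f2](subrK (h * 'X_k)) mcoeffD mcoeffXM.
move: mk; rewrite -eqn0Ngt => ->; rewrite addr0.
by move/Hh; rewrite Bm.
Qed.

Lemma adjoin_congr A f1 f2 g : up_closed A -> monomial_ideal A (f1 - f2) ->
  adjoin (monomial_ideal A) f1 g -> adjoin (monomial_ideal A) f2 g.
Proof.
move=> upA H [h Hh]; exists h.
case: (monomial_ideal_ideal K upA) => _ AD AM.
by have := AD _ _ Hh (AM h _ H); congr monomial_ideal; ring.
Qed.

Lemma relation_congr A f1 f2 f2' : up_closed A -> monomial_ideal A (f2 - f2') ->
    (forall g, adjoin (monomial_ideal A) f1 (g * f2') -> adjoin (monomial_ideal A) f1 g) ->
  forall g, adjoin (monomial_ideal A) f1 (g * f2) -> adjoin (monomial_ideal A) f1 g.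
Proof.
move=> upA H HA g [h Hh]; apply: HA; exists h.
have hA := monomial_ideal_ideal K upA; case: (hA) => _ AD AM.
by have := idealB hA Hh (AM g _ H); congr monomial_ideal; ring.
Qed.

(** The class of degree p bounds every regular sequence by n - p, and [fs] attains this length. The
    quotient by [fs] is nonzero since all generators have zero constant term. *)
Lemma depth_eq_monomial s P p (c : {set 'I_n} -> S) fs :
    (forall f, in_ideal s f <-> monomial_ideal P f) -> ~~ P 0%MM ->
    koszul_class (monomial_ideal P) p c -> (p + size fs = n)%N ->
    all (@in_max_ideal K n) fs ->
    (forall l : nat, (l < size fs)%N -> forall g, in_ideal (s ++ take l fs) (g * fs`_l) ->
      in_ideal (s ++ take l fs) g) ->
  depth_eq s (size fs).
Proof.
move=> sP P0 [c1 c2 c3] pn fs0 freg; split.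
  exists fs; split=> //; split=> //; split=> [|one_in]; first exact: freg.
  suff s0 : all (@in_max_ideal K n) (s ++ fs).
    by have /eqP := in_ideal_augment s0 one_in; rewrite mcoeff1 eqxx oner_eq0.
  rewrite all_cat fs0 andbT; apply/allP => f /in_ideal_mem/sP Pf.
  by rewrite /in_max_ideal; apply: contraNT P0; apply: Pf.
move=> fs' Hfs'; rewrite -(leq_add2l p) pn.
apply: regular_seq_size Hfs'; split; [exact: c1|by move=> G; apply/sP; apply: c2|].
by case=> b Hb; apply: c3; exists b => F; apply/sP; apply: Hb.
Qed.

Lemma nzd_in_ideal s P f g : (forall f, in_ideal s f <-> monomial_ideal P f) ->
  nzd P f -> in_ideal (s ++ [::]) (g * f) -> in_ideal (s ++ [::]) g.
Proof. by move=> sP Pf; rewrite cats0 => /sP/Pf/sP. Qed.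

Lemma relation_in_ideal s P f1 f2 g : (forall f, in_ideal s f <-> monomial_ideal P f) ->
    (forall g, adjoin (monomial_ideal P) f1 (g * f2) -> adjoin (monomial_ideal P) f1 g) ->
  in_ideal (s ++ [:: f1]) (g * f2) -> in_ideal (s ++ [:: f1]) g.
Proof.
move=> sP H; rewrite cats1 => /in_ideal_rcons[h /sP Hh].
apply/in_ideal_rcons; have [|h' Hh'] := H g; first by exists h.
by exists h'; apply/sP.
Qed.

End NonZeroDivisors.

(** * Distinctness of variables as rewrite rules *)

Lemma uniq2E (T : eqType) (x y : T) : uniq [:: x; y] ->
  ((x == y) = false) * ((y == x) = false).
Proof. by rewrite /= inE andbT eq_sym => /negPf. Qed.

Lemma uniq3E (T : eqType) (x y z : T) : uniq [:: x; y; z] ->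
  ((x == y) = false) * ((y == x) = false) * ((x == z) = false) * ((z == x) = false) *
  ((y == z) = false) * ((z == y) = false).
Proof.
rewrite /= !inE negb_or andbT => /andP[/andP[/negPf xy /negPf xz] /negPf yz].
by rewrite ![_ == x]eq_sym ![_ == y]eq_sym [y == x]eq_sym xy xz yz.
Qed.

Lemma uniq4E (T : eqType) (x y z t : T) : uniq [:: x; y; z; t] ->
  ((x == y) = false) * ((y == x) = false) * ((x == z) = false) * ((z == x) = false) *
  ((y == z) = false) * ((z == y) = false) * ((x == t) = false) * ((t == x) = false) *
  ((y == t) = false) * ((t == y) = false) * ((z == t) = false) * ((t == z) = false).
Proof.
move=> U; have U1 : uniq [:: x; y; z] by move: U; rewrite /= !inE; case/and4P; lia.
have U2 : uniq [:: y; z; t] by case/andP: U.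
have U3 : uniq [:: x; z; t] by move: U; rewrite /= !inE; case/and4P; lia.
by rewrite !(uniq3E U1) !(uniq3E U2) !(uniq3E U3).
Qed.

(** * Adjacent heavy edges obstruct integral closedness *)

Section IntegralClosure.
Import Order.TTheory GRing.Theory.
Local Open Scope ring_scope.
Variables (K : fieldType) (n : nat).
Local Notation S := {mpoly K[n]}.
Implicit Types (f g h : S) (s : seq S).

Lemma pow_gens_exp s f g a b : f \in s -> g \in s -> f ^+ a * g ^+ b \in pow_gens s (a + b).
Proof.
move=> fs gs; elim: a => [|a IH] /=; last by rewrite exprS -mulrA allpairs_f.
by elim: b => [|b IH] /=; rewrite mul1r ?inE // exprS allpairs_f // -[_ ^+ b]mul1r.
Qed.

(** The equation of integral dependence is T^N - f^N = 0, whose constant coefficient lies in I^N. *)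
Lemma integral_of_exp s f N : (0 < N)%N -> in_ideal (pow_gens s N) (f ^+ N) ->
  integral_over_ideal s f.
Proof.
move=> N0 HN; exists N, (fun i => if i == N then - f ^+ N else 0); split=> //; split.
  move=> i _; case: (in_ideal_ideal (pow_gens s i)) => I0 ID IM.
  by case: eqP => [iN|//]; rewrite -mulN1r; apply: IM; rewrite iN.
rewrite big_nat_recr //= eqxx subnn expr0 mulr1 big_nat big1 ?add0r ?subrr // => i.
by case/andP=> _ iN; rewrite ltn_eqF ?mul0r.
Qed.

(* With N = p q, the N-th power of x^(p-1) y^max(p,q) z^(q-1) is divisible by
   (x^p y^p)^(p q - q) (y^q z^q)^q. *)
Lemma adjacent_not_integrally_closed s (x y z : 'I_n) p q : uniq [:: x; y; z] ->
    'X_[(U_(x) + U_(y)) *+ p] \in s -> 'X_[(U_(y) + U_(z)) *+ q] \in s ->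
    (1 < p)%N -> (1 < q)%N -> integrally_closed s ->
  in_ideal s 'X_[U_(x) *+ p.-1 + U_(y) *+ maxn p q + U_(z) *+ q.-1].
Proof.
move=> /uniq3E D ps qs p1 q1; apply.
apply: (@integral_of_exp _ _ (p * q)); first by rewrite muln_gt0; lia.
have aq : (p.-1 * q + q = p * q)%N by case: (p) p1 => // p' _; rewrite mulSn addnC.
have := pow_gens_exp (p.-1 * q) q ps qs; rewrite aq => /in_ideal_mem.
set g := _ * _; set s' := pow_gens _ _ => gI.
rewrite mpolyXn.
set m := (_ *+ (p * q))%MM.
pose m' := ((U_(x) + U_(y)) *+ p *+ (p.-1 * q) + (U_(y) + U_(z)) *+ q *+ q)%MM.
have mm' : (m' <= m)%MM.
  apply/mnm_lepP => k; rewrite /m /m' !(mnmDE, mulmnE, mnm1E).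
  have [<-|_] := eqVneq x k.
    by rewrite !D /= !(addn0, add0n, mul0n, mul1n) mulnCA.
  have [<-|_] := eqVneq y k.
    rewrite !D /= !(addn0, add0n, mul0n, mul1n) -aq mulnDr.
    by rewrite leq_add // leq_mul ?leq_maxl ?leq_maxr.
  case: (z == k); rewrite /= !(addn0, add0n, mul0n, mul1n) // mulnA leq_mul2r.
  (* The exponent of z needs q <= 2 (q - 1) <= p (q - 1), which uses that both weights are at least
     2. *)
  by apply/orP; right; apply: (@leq_trans (q.-1 * 2)); [lia|rewrite leq_mul2l p1 orbT].
rewrite -(submK mm') mpolyXD; case: (in_ideal_ideal s') => I0 ID IM.
by have <- : g = 'X_[m']; [rewrite /g /m' mpolyXD !mpolyXn|apply: IM].
Qed.

End IntegralClosure.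

(** * Edges as conditions on exponents *)

Lemma eq_monomial_ideal (K : fieldType) n (P Q : pred 'X_{1..n}) (f : {mpoly K[n]}) :
  P =1 Q -> monomial_ideal P f <-> monomial_ideal Q f.
Proof. by move=> PQ; split=> H m /H; rewrite PQ. Qed.

Definition edge n (x y : 'I_n) w (m : 'X_{1..n}) := (w <= m x) && (w <= m y).

Lemma lem_edge n (x y : 'I_n) w m : x != y ->
  (((U_(x) + U_(y)) *+ w <= m)%MM : bool) = edge x y w m.
Proof.
move=> xy; apply/mnm_lepP/andP => [H|[wx wy] k].
  have := (H x, H y); rewrite !mulmnE !mnmDE !mnm1E !eqxx [y == x]eq_sym (negPf xy).
  by rewrite !mul1n => -[].
rewrite mulmnE mnmDE !mnm1E; have [<-|] := eqVneq x k.
  by rewrite eq_sym (negPf xy) mul1n.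
by have [<-|] := eqVneq y k; rewrite /= ?mul1n // mul0n.
Qed.

(** Evaluates the exponents at distinct variables, with [D] the rewrite rules for their
    distinctness, and leaves arithmetic to [lia]. *)
Ltac mnm D := rewrite /edge /= ?(mnmDE, mulmnE, mnm1E, mnm0E) ?eqxx ?D /=; lia.

(** * Regularity and depth of each type of path, with freely named vertices *)

Section Paths.
Import Order.TTheory GRing.Theory.
Local Open Scope ring_scope.
Variables (K : fieldType) (n : nat).
Local Notation S := {mpoly K[n]}.
Implicit Types (f g h : S) (m u : 'X_{1..n}) (P Q R A B : pred 'X_{1..n}) (x y z t k : 'I_n).

Lemma linear_in_var x k : linear_in (fun m => (0 < m x)%N) k.
Proof.
have [->|xk] := eqVneq k x; [left|right] => m; rewrite mnmDE mnm1E ?eqxx ?addn1 //.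
by rewrite (negPf xk) addn0.
Qed.

Lemma linear_in_or P Q k : linear_in P k -> linear_in Q k -> linear_in (fun m => P m || Q m) k.
Proof.
case=> Pk; first by left=> m; rewrite Pk.
by case=> Qk; [left|right] => m; rewrite ?Pk Qk ?orbT.
Qed.

(** The coefficient is x^(w-1) y^w, of degree 2 (w - 1) + 1 = 2 w - 1; it sits on x |: B, in
    homological degree |B| + 1. *)
Lemma koszul_class_path P x y (B : {set 'I_n}) w : up_closed P -> x != y ->
    x \notin B -> y \notin B -> (0 < w)%N ->
    ~~ P ((U_(x) + U_(y)) *+ w.-1 + U_(y))%MM -> ~~ P ((U_(x) + U_(y)) *+ w.-1 + U_(x))%MM ->
    (forall k, k \in x |: B -> P ((U_(x) + U_(y)) *+ w.-1 + U_(y) + U_(k))%MM) ->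
  exists c, koszul_class (monomial_ideal (K := K) P) #|B|.+1 c /\
    forall F, c F \is (2 * w - 1).-homog.
Proof.
move=> upP xy xB yB w0 Py Px PB; eexists; split.
  apply: (koszul_class_monomial K upP xy xB yB _ Py Px PB) => k kx ky.
  by rewrite mulmnE mnmDE !mnm1E ![_ == k]eq_sym (negPf kx) (negPf ky).
move=> F; have := @monomial_chain_dhomog K n (x |: B) ((U_(x) + U_(y)) *+ w.-1 + U_(y))%MM F.
by rewrite mdegD mdegMn mdegD !mdeg1 (_ : (_ + _)%N = (2 * w - 1)%N) //; lia.
Qed.

Lemma max_ideal_var x : in_max_ideal ('X_x : S).
Proof. by rewrite /in_max_ideal mcoeffX mnm1_eq0. Qed.

Lemma max_idealD f g : in_max_ideal f -> in_max_ideal g -> in_max_ideal (f + g).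
Proof. by rewrite /in_max_ideal mcoeffD => /eqP-> /eqP->; rewrite addr0. Qed.

(** Split (x^w y^w) as the intersection of (x^w) and (y^w): modulo each, together with [R], one
    variable is nilpotent and the other regular. *)
Lemma nzd_edge R x y w : x != y -> up_closed R ->
    (forall m, R (m + U_(x))%MM = R m) -> (forall m, R (m + U_(y))%MM = R m) ->
  nzd (fun m => edge x y w m || R m) ('X_x + 'X_y : S).
Proof.
move=> xy upR Rx Ry.
apply: (@eq_nzd _ _ (fun m => ((w <= m x)%N || R m) && ((w <= m y)%N || R m))).
  by move=> m; rewrite /edge orb_andl.
apply: nzd_and; [rewrite addrC|]; apply: (nzd_add_nilpotent (N := w)).
- by move=> m u /orP[wm|/upR->]; rewrite ?orbT // mnmDE (leq_trans wm) ?leq_addr.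
- by apply: nzd_var => m; rewrite Ry mnmDE mnm1E eq_sym (negPf xy) addn0.
- by move=> m ->.
- by move=> m u /orP[wm|/upR->]; rewrite ?orbT // mnmDE (leq_trans wm) ?leq_addr.
- by apply: nzd_var => m; rewrite Rx mnmDE mnm1E (negPf xy) addn0.
- by move=> m ->.
Qed.

Lemma nzd_add_var P x y : up_closed P -> (forall m, P (m + U_(x))%MM = P m) ->
  (forall m, (0 < m y)%N -> P m) -> nzd P ('X_x + 'X_y : S).
Proof. by move=> upP Px Py; apply: (nzd_add_nilpotent (N := 1)) => //; apply: nzd_var. Qed.

Lemma reg_depth_path P s x y (B : {set 'I_n}) w fs :
    (forall f, in_ideal s f <-> monomial_ideal P f) -> up_closed P -> x != y ->
    x \notin B -> y \notin B -> (0 < w)%N ->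
    ~~ P ((U_(x) + U_(y)) *+ w.-1 + U_(y))%MM -> ~~ P ((U_(x) + U_(y)) *+ w.-1 + U_(x))%MM ->
    (forall k, k \in x |: B -> P ((U_(x) + U_(y)) *+ w.-1 + U_(y) + U_(k))%MM) ->
    (forall d, (2 * w <= d)%N -> koszul_vanish K P d) ->
    (#|B|.+1 + size fs = n)%N -> all (@in_max_ideal K n) fs ->
    (forall l : nat, (l < size fs)%N -> forall g, in_ideal (s ++ take l fs) (g * fs`_l) ->
      in_ideal (s ++ take l fs) g) ->
  reg_eq s (2 * w - 1) /\ depth_eq s (size fs).
Proof.
move=> sP upP xy xB yB w0 Py Px PB V Bn fs0 freg.
have [c [Hc cd]] := koszul_class_path upP xy xB yB w0 Py Px PB.
split; first by apply: reg_eq_monomial sP Hc cd _ => d wd; apply: V; lia.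
apply: depth_eq_monomial sP _ Hc Bn fs0 freg.
by apply: contraNN Py => /upP; rewrite -[X in _ -> is_true (P X)]add0m.
Qed.

Lemma reg_depth_path2 s x y w : n = 2 -> uniq [:: x; y] -> (0 < w)%N ->
    (forall f, in_ideal s f <-> monomial_ideal (edge x y w) f) ->
  reg_eq s (2 * w - 1) /\ depth_eq s 1.
Proof.
move=> n2 /uniq2E D w0 sP.
have xy : x != y by rewrite D.
have up : up_closed (edge x y w) by move=> m u; mnm D.
apply: (@reg_depth_path _ _ x y set0 w [:: 'X_x + 'X_y] sP up xy); rewrite ?inE //.
- by mnm D.
- by mnm D.
- by move=> k; rewrite !inE orbF => /eqP->; mnm D.
- move=> d wd; apply: (@eq_koszul_vanish _ _ (fun m => (w <= m x)%N && (w <= m y)%N || false)).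
    by move=> m; rewrite orbF.
  apply: koszul_vanish_pair => //; first by move=> k; right.
  by lia.
- by rewrite cards0; apply: esym.
- by rewrite /= andbT max_idealD ?max_ideal_var.
case=> // _ g; apply: nzd_in_ideal sP _.
apply: (@eq_nzd _ _ (fun m => edge x y w m || false)) => [m|]; first by rewrite orbF.
by apply: nzd_edge.
Qed.

Lemma reg_depth_path3 s x y z w : n = 3 -> uniq [:: x; y; z] -> (1 < w)%N ->
    (forall f, in_ideal s f <-> monomial_ideal (fun m => edge x y w m || edge y z 1 m) f) ->
  reg_eq s (2 * w - 1) /\ depth_eq s 1.
Proof.
move=> n3 /uniq3E D w0 sP; set P := fun m => _ in sP.
have xy : x != y by rewrite D.
have up : up_closed P by move=> m u; rewrite /P; mnm D.
apply: (@reg_depth_path _ _ x y [set z] w [:: 'X_x + 'X_y] sP up xy); rewrite ?inE ?D //.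
- by lia.
- by rewrite /P; mnm D.
- by rewrite /P; mnm D.
- by rewrite /P; move=> k; rewrite !inE => /orP[]/eqP->; mnm D.
(* I + (z) = (x^w y^w, z) and I : z = (y). *)
- move=> d wd; apply: (koszul_vanish_colon (k := z)) => //; first by lia.
    apply: (@eq_koszul_vanish _ _ (fun m => (w <= m x)%N && (w <= m y)%N || (0 < m z)%N)).
      by move=> m; rewrite /P; mnm D.
    apply: koszul_vanish_pair => //; try by move=> m; mnm D.
    - by move=> m u; mnm D.
    - by move=> k; apply: linear_in_var.
    - by lia.
  apply: (@eq_koszul_vanish _ _ (fun m => (0 < m y)%N)).
    by move=> m; rewrite /P; mnm D.
  apply: koszul_vanish_linear; [by move=> m u; mnm D|by lia|].
  by move=> k; apply: linear_in_var.
- by rewrite cards1; apply: esym.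
- by rewrite /= andbT max_idealD ?max_ideal_var.
case=> // _ g; apply: nzd_in_ideal sP _.
(* I is the intersection of (y) and (x^w y^w, z). *)
apply: (@eq_nzd _ _ (fun m => (0 < m y)%N && (edge x y w m || (0 < m z)%N))).
  by move=> m; rewrite /P; mnm D.
apply: nzd_and; first by apply: nzd_add_var => //; move=> m; try move=> u; mnm D.
by apply: nzd_edge => //; move=> m; try move=> u; mnm D.
Qed.

Lemma reg_depth_path4_outer s x y z t p q : n = 4 -> uniq [:: x; y; z; t] ->
    (1 < p)%N -> (0 < q <= p)%N ->
    (forall f, in_ideal s f <->
      monomial_ideal (fun m => [|| edge x y p m, edge y z 1 m | edge z t q m]) f) ->
  reg_eq s (2 * p - 1) /\ depth_eq s 2.
Proof.
move=> n4 /uniq4E D p1 /andP[q0 qp] sP; set P := fun m => _ in sP.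
have xy : x != y by rewrite D.
have zt : z != t by rewrite D.
have up : up_closed P by move=> m u; rewrite /P; mnm D.
pose f1 : S := 'X_x + 'X_y; pose f2 : S := 'X_z + 'X_t.
(* I is the intersection of A = (x^p y^p, z) and B = (y, z^q t^q), while A + B = (y, z). *)
pose A m := edge x y p m || (0 < m z)%N; pose B m := (0 < m y)%N || edge z t q m.
have upA : up_closed A by move=> m u; rewrite /A; mnm D.
have upB : up_closed B by move=> m u; rewrite /B; mnm D.
have PAB m : P m = A m && B m by rewrite /P /A /B; mnm D.
apply: (@reg_depth_path _ _ x y [set z] p [:: f1; f2] sP up xy); rewrite ?inE ?D //.
- by lia.
- by rewrite /P; mnm D.
- by rewrite /P; mnm D.
- by rewrite /P; move=> k; rewrite !inE => /orP[]/eqP->; mnm D.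
(* I + (z) = (x^p y^p, z) and I : z = (y, z^(q-1) t^q). The latter needs 2 q - 1 <= d - 1, which
   holds because q <= p. *)
- move=> d wd; apply: (koszul_vanish_colon (k := z)) => //; first by lia.
    apply: (@eq_koszul_vanish _ _ (fun m => (p <= m x)%N && (p <= m y)%N || (0 < m z)%N)).
      by move=> m; rewrite /P; mnm D.
    apply: koszul_vanish_pair => //; try by move=> m; mnm D.
    - by move=> m u; mnm D.
    - by move=> k; apply: linear_in_var.
    - by lia.
  apply: (@eq_koszul_vanish _ _ (fun m => (q.-1 <= m z)%N && (q <= m t)%N || (0 < m y)%N)).
    by move=> m; rewrite /P; mnm D.
  apply: koszul_vanish_pair => //; try by move=> m; mnm D.
  - by move=> m u; mnm D.
  - by move=> k; apply: linear_in_var.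
  - by lia.
- by rewrite cards1; apply: esym.
- by rewrite /= andbT !max_idealD ?max_ideal_var.
have Bf1 : monomial_ideal B (f1 - 'X_x).
  by rewrite /f1 addrC addKr; apply: monomial_idealX; rewrite /B; mnm D.
have Bf1' : monomial_ideal B ('X_x - f1).
  rewrite -opprB -mulN1r; by case: (monomial_ideal_ideal K upB) => _ _; apply.
case=> [|[|//]] _ g; rewrite /=.
  apply: nzd_in_ideal sP _; apply: (eq_nzd (fun m => esym (PAB m))); apply: nzd_and.
    by apply: nzd_edge => //; move=> m; try move=> u; mnm D.
  by apply: nzd_add_var => //; move=> m; rewrite /B; try move=> u; mnm D.
apply: relation_in_ideal => [f|].
  by rewrite sP; apply: (eq_monomial_ideal _ PAB).
apply: relation_and => //.
- apply: (@eq_nzd _ _ (fun m => (0 < m y)%N || (0 < m z)%N)).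
    by move=> m; rewrite /A /B; mnm D.
  by apply: nzd_add_var => //; move=> m; try move=> u; mnm D.
(* Modulo A, f2 is congruent to t, which can be exchanged with f1. *)
- apply: (relation_congr (f2' := 'X_t)) => //.
    by rewrite /f2 addrK; apply: monomial_idealX; rewrite /A; mnm D.
  apply: relation_swap => //; last by apply: nzd_var => m; rewrite /A; mnm D.
  apply: (@eq_nzd _ _ (fun m => edge x y p m || ((0 < m z)%N || (0 < m t)%N))).
    by move=> m; rewrite /A orbA.
  by apply: nzd_edge => //; move=> m; try move=> u; mnm D.
(* Modulo B, f1 is congruent to x, and B + (x) is monomial. *)
- move=> h /(adjoin_congr upB Bf1) Hh; apply: (adjoin_congr upB Bf1').
  apply: relation_monomial Hh => //.
  apply: (@eq_nzd _ _ (fun m => edge z t q m || ((0 < m y)%N || (0 < m x)%N))).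
    by move=> m; rewrite /B; mnm D.
  by apply: nzd_edge => //; move=> m; try move=> u; mnm D.
Qed.

Lemma nzd_add_mem P f h : up_closed P -> nzd P f -> monomial_ideal P h -> nzd P (f + h).
Proof.
move=> upP Pf Ph g Pg; apply: Pf.
have hI := monomial_ideal_ideal K upP; case: (hI) => _ _ JM.
by have := idealB hI Pg (JM g _ Ph); congr monomial_ideal; ring.
Qed.

Lemma reg_depth_path4_inner s x y z t w : n = 4 -> uniq [:: x; y; z; t] -> (1 < w)%N ->
    (forall f, in_ideal s f <->
      monomial_ideal (fun m => [|| edge x y 1 m, edge y z w m | edge z t 1 m]) f) ->
  reg_eq s (2 * w - 1) /\ depth_eq s 1.
Proof.
move=> n4 /uniq4E D w1 sP; set P := fun m => _ in sP.
have yz : y != z by rewrite D.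
have up : up_closed P by move=> m u; rewrite /P; mnm D.
(* The term x t is there for the component (y, z), where y + z vanishes. All other components
   contain x or t, so that x t vanishes there and y + z is regular. *)
pose f1 : S := 'X_x * 'X_t + 'X_y + 'X_z.
apply: (@reg_depth_path _ _ y z [set x; t] w [:: f1] sP up yz); rewrite ?inE ?D //.
- by lia.
- by rewrite /P; mnm D.
- by rewrite /P; mnm D.
- by rewrite /P; move=> k; rewrite !inE => /or3P[]/eqP->; mnm D.
(* I + (y) = (z t, y), and J = I : y = (x, y^(w-1) z^w, z t) is cut once more by t. *)
- move=> d wd; apply: (koszul_vanish_colon (k := y)) => //; first by lia.
    apply: (@eq_koszul_vanish _ _ (fun m => (1 <= m z)%N && (1 <= m t)%N || (0 < m y)%N)).
      by move=> m; rewrite /P; mnm D.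
    apply: koszul_vanish_pair => //; try by move=> m; mnm D.
    - by rewrite D.
    - by move=> m u; mnm D.
    - by move=> k; apply: linear_in_var.
    - by lia.
  (* J + (t) = (x, t, y^(w-1) z^w) needs degree 2 w - 1, and J : t = (x, z) only a positive
     degree. *)
  apply: (koszul_vanish_colon (k := t)); try by lia.
  + by move=> m u; rewrite /P; mnm D.
  + apply: (@eq_koszul_vanish _ _ (fun m => (w.-1 <= m y)%N && (w <= m z)%N ||
        ((0 < m x)%N || (0 < m t)%N))).
      by move=> m; rewrite /P; mnm D.
    apply: koszul_vanish_pair => //; try by move=> m; mnm D.
    - by move=> m u; mnm D.
    - by move=> k; apply: linear_in_or; apply: linear_in_var.
    - by lia.
  apply: (@eq_koszul_vanish _ _ (fun m => (0 < m x)%N || (0 < m z)%N)).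
    by move=> m; rewrite /P; mnm D.
  apply: koszul_vanish_linear; [by move=> m u; mnm D|by lia|].
  by move=> k; apply: linear_in_or; apply: linear_in_var.
- by rewrite cards2 D; apply: esym.
- rewrite /= andbT !max_idealD ?max_ideal_var //.
  by rewrite /in_max_ideal rmorphM /= (eqP (max_ideal_var x)) mul0r.
case=> // _ g; apply: nzd_in_ideal sP _.
have nzd_z Q : up_closed Q -> (forall m, Q (m + U_(z))%MM = Q m) ->
    (forall m, (w <= m y)%N -> Q m) -> (forall m, (0 < m x)%N -> (0 < m t)%N -> Q m) -> nzd Q f1.
  move=> upQ Qz Qy Qxt; rewrite /f1 -addrA addrC; apply: nzd_add_mem => //.
    by rewrite addrC; apply: (nzd_add_nilpotent (N := w)) => //; apply: nzd_var.
  by rewrite -mpolyXD; apply: monomial_idealX; apply: Qxt; mnm D.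
have nzd_y Q : up_closed Q -> (forall m, Q (m + U_(y))%MM = Q m) ->
    (forall m, (w <= m z)%N -> Q m) -> (forall m, (0 < m x)%N -> (0 < m t)%N -> Q m) -> nzd Q f1.
  move=> upQ Qz Qy Qxt; rewrite /f1 -addrA addrC; apply: nzd_add_mem => //.
    by apply: (nzd_add_nilpotent (N := w)) => //; apply: nzd_var.
  by rewrite -mpolyXD; apply: monomial_idealX; apply: Qxt; mnm D.
(* The irredundant irreducible decomposition of the ideal. *)
apply: (@eq_nzd _ _ (fun m => ((0 < m x)%N || (0 < m z)%N) &&
  (((0 < m y)%N || (0 < m t)%N) && (((0 < m y)%N || (0 < m z)%N) &&
  (((0 < m x)%N || (w <= m y)%N || (0 < m t)%N) &&
   ((0 < m x)%N || (w <= m z)%N || (0 < m t)%N)))))).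
  by move=> m; rewrite /P; mnm D.
do 4?apply: nzd_and.
- by apply: nzd_y => m *; mnm D.
- by apply: nzd_z => m *; mnm D.
(* On (y, z) the product x t is regular, and y and z are zero. *)
- have upQ : up_closed (fun m => (0 < m y)%N || (0 < m z)%N) by move=> m u; mnm D.
  do 2!(apply: (nzd_add_nilpotent (N := 1)) => //; last by move=> m; mnm D).
  by apply: nzd_mul; apply: nzd_var => m; mnm D.
- by apply: nzd_z => m *; mnm D.
- by apply: nzd_y => m *; mnm D.
Qed.

End Paths.

(** * From lists of generators to the path types, and the final case analysis *)

Section PathIdeals.
Import Order.TTheory GRing.Theory.
Local Open Scope ring_scope.
Variables (K : fieldType).
Implicit Types (w : nat -> nat).

Lemma path_gensE n w (x : 'I_n) (y : 'I_n) : y = x.+1 :> nat ->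
  (xvar K n x * xvar K n x.+1) ^+ w x = 'X_[(U_(x) + U_(y)) *+ w x].
Proof. by move=> yx; rewrite -yx /xvar !valK -mpolyXD mpolyXn. Qed.

Local Notation o2 i := (@Ordinal 2 i isT).
Local Notation o3 i := (@Ordinal 3 i isT).
Local Notation o4 i := (@Ordinal 4 i isT).

Lemma path_gens2 w : path_gens K 2 w =
  [seq 'X_[u] | u <- [:: ((U_(o2 0) + U_(o2 1)) *+ w 0%N)%MM]].
Proof. by rewrite /path_gens /= (@path_gensE 2 w (o2 0) (o2 1)). Qed.

Lemma path_gens3 w : path_gens K 3 w =
  [seq 'X_[u] | u <- [:: ((U_(o3 0) + U_(o3 1)) *+ w 0%N)%MM; ((U_(o3 1) + U_(o3 2)) *+ w 1%N)%MM]].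
Proof.
by rewrite /path_gens /= (@path_gensE 3 w (o3 0) (o3 1)) // (@path_gensE 3 w (o3 1) (o3 2)).
Qed.

Lemma path_gens4 w : path_gens K 4 w =
  [seq 'X_[u] | u <- [:: ((U_(o4 0) + U_(o4 1)) *+ w 0%N)%MM; ((U_(o4 1) + U_(o4 2)) *+ w 1%N)%MM;
    ((U_(o4 2) + U_(o4 3)) *+ w 2%N)%MM]].
Proof.
by rewrite /path_gens /= (@path_gensE 4 w (o4 0) (o4 1)) // (@path_gensE 4 w (o4 1) (o4 2)) //
  (@path_gensE 4 w (o4 2) (o4 3)).
Qed.

Lemma edgeC n (x y : 'I_n) p m : edge x y p m = edge y x p m.
Proof. exact: andbC. Qed.

Lemma in_path_ideal2 w f : in_ideal (path_gens K 2 w) f <->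
  monomial_ideal (edge (o2 0) (o2 1) (w 0%N)) f.
Proof.
rewrite path_gens2 in_ideal_monomial; apply: eq_monomial_ideal => m.
by rewrite /= !lem_edge // orbF.
Qed.

Lemma in_path_ideal3 w f : in_ideal (path_gens K 3 w) f <->
  monomial_ideal (fun m => edge (o3 0) (o3 1) (w 0%N) m || edge (o3 1) (o3 2) (w 1%N) m) f.
Proof.
rewrite path_gens3 in_ideal_monomial; apply: eq_monomial_ideal => m.
by rewrite /= !lem_edge // orbF.
Qed.

Lemma in_path_ideal4 w f : in_ideal (path_gens K 4 w) f <->
  monomial_ideal (fun m => [|| edge (o4 0) (o4 1) (w 0%N) m, edge (o4 1) (o4 2) (w 1%N) m
    | edge (o4 2) (o4 3) (w 2%N) m]) f.
Proof.
rewrite path_gens4 in_ideal_monomial; apply: eq_monomial_ideal => m.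
by rewrite /= !lem_edge // orbF.
Qed.

(** If both weights exceed 1, the integral monomial has exponents w_0 - 1 and w_1 - 1 at the end
    vertices, too small for either edge. *)
Lemma integrally_closed_path3 w : (0 < w 0)%N -> (0 < w 1)%N ->
  integrally_closed (path_gens K 3 w) -> w 0%N = 1%N \/ w 1%N = 1%N.
Proof.
move=> w0 w1 ic; have [w02|] := ltnP 1 (w 0%N); last by left; lia.
have [w12|] := ltnP 1 (w 1%N); last by right; lia.
have U : uniq [:: o3 0; o3 1; o3 2] by [].
have := adjacent_not_integrally_closed U _ _ w02 w12 ic.
rewrite path_gens3 !map_f ?inE ?eqxx ?orbT // => /(_ isT isT).
rewrite -path_gens3 => /in_path_ideal3.
set m := (_ + _)%MM => /(_ m); rewrite mcoeffX eqxx oner_eq0 => /(_ isT).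
by rewrite /m; mnm (uniq3E U).
Qed.

(** As for three vertices, on either pair of adjacent edges; the remaining edge does not divide the
    monomial either, since its far vertex has exponent 0. *)
Lemma integrally_closed_path4 w : (0 < w 0)%N -> (0 < w 1)%N -> (0 < w 2)%N ->
  integrally_closed (path_gens K 4 w) -> w 1%N = 1%N \/ (w 0%N = 1%N /\ w 2%N = 1%N).
Proof.
move=> w0 w1 w2 ic; have [w12|] := ltnP 1 (w 1%N); last by left; lia.
have U : uniq [:: o4 0; o4 1; o4 2; o4 3] by [].
right; split; apply/eqP; rewrite eqn_leq ?w0 ?w2 andbT leqNgt; apply/negP => w02.
  have U' : uniq [:: o4 0; o4 1; o4 2] by [].
  have := adjacent_not_integrally_closed U' _ _ w02 w12 ic.
  rewrite path_gens4 !map_f ?inE ?eqxx ?orbT // => /(_ isT isT).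
  rewrite -path_gens4 => /in_path_ideal4.
  set m := (_ + _)%MM => /(_ m); rewrite mcoeffX eqxx oner_eq0 => /(_ isT).
  by rewrite /m; mnm (uniq4E U).
have U' : uniq [:: o4 1; o4 2; o4 3] by [].
have := adjacent_not_integrally_closed U' _ _ w12 w02 ic.
rewrite path_gens4 !map_f ?inE ?eqxx ?orbT // => /(_ isT isT).
rewrite -path_gens4 => /in_path_ideal4.
set m := (_ + _)%MM => /(_ m); rewrite mcoeffX eqxx oner_eq0 => /(_ isT).
by rewrite /m; mnm (uniq4E U).
Qed.

Lemma reg_depth_path_gens3 w : (0 < w 0)%N -> (0 < w 1)%N -> (1 < maxn (w 0) (w 1))%N ->
    integrally_closed (path_gens K 3 w) ->
  reg_eq (path_gens K 3 w) (2 * maxn (w 0) (w 1) - 1)%N /\ depth_eq (path_gens K 3 w) 1.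
Proof.
move=> w0 w1 W ic; have [w01|w11] := integrally_closed_path3 w0 w1 ic.
  rewrite w01 in W *; rewrite (maxn_idPr w1) in W *.
  (* The heavy edge comes second, so the path is read backwards. *)
  apply: (@reg_depth_path3 _ _ _ (o3 2) (o3 1) (o3 0)) => // f.
  rewrite in_path_ideal3; apply: eq_monomial_ideal => m.
  by rewrite w01 orbC edgeC [X in _ || X]edgeC.
rewrite w11 in W *; rewrite (maxn_idPl w0) in W *.
apply: (@reg_depth_path3 _ _ _ (o3 0) (o3 1) (o3 2)) => // f.
by rewrite in_path_ideal3 w11.
Qed.

Lemma reg_depth_path_gens4 w : (0 < w 0)%N -> (0 < w 1)%N -> (0 < w 2)%N ->
    (1 < maxn (w 0) (maxn (w 1) (w 2)))%N -> integrally_closed (path_gens K 4 w) ->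
  reg_eq (path_gens K 4 w) (2 * maxn (w 0) (maxn (w 1) (w 2)) - 1)%N /\
  depth_eq (path_gens K 4 w) (if w 1%N == 1%N then 2 else 1).
Proof.
move=> w0 w1 w2 W ic; have [w11|[w01 w21]] := integrally_closed_path4 w0 w1 w2 ic; last first.
  have WE : (maxn (w 0) (maxn (w 1) (w 2)) = w 1)%N by lia.
  rewrite WE in W *; rewrite gtn_eqF //.
  apply: (@reg_depth_path4_inner _ _ _ (o4 0) (o4 1) (o4 2) (o4 3)) => // f.
  by rewrite in_path_ideal4 w01 w21.
rewrite w11 eqxx; have [w20|w02] := leqP (w 2%N) (w 0%N).
  rewrite w11 (_ : maxn _ _ = w 0%N) in W *; last by lia.
  apply: (@reg_depth_path4_outer _ _ _ (o4 0) (o4 1) (o4 2) (o4 3) _ (w 2%N)) => // [|f].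
    by rewrite w2.
  by rewrite in_path_ideal4 w11.
rewrite w11 (_ : maxn _ _ = w 2%N) in W *; last by lia.
(* The last edge is the heavier outer one; reversing the path puts it first. *)
apply: (@reg_depth_path4_outer _ _ _ (o4 3) (o4 2) (o4 1) (o4 0) _ (w 0%N)) => // [|f].
  by rewrite w0 ltnW.
rewrite in_path_ideal4; apply: eq_monomial_ideal => m; rewrite w11.
by rewrite (edgeC (o4 3)) (edgeC (o4 2) (o4 1)) (edgeC (o4 1) (o4 0))
  orbC orbAC orbC.
Qed.

End PathIdeals.

Theorem theorem4p8 (K : fieldType) (n : nat) (w : nat -> nat) :
  (2 <= n <= 4)%N ->
  (forall i, (i < n.-1)%N -> (0 < w i)%N) ->
  (exists i, (i < n.-1)%N /\ (2 <= w i)%N) ->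
  integrally_closed (path_gens K n w) ->
  let W := (\max_(i < n.-1) w i)%N in
  reg_eq (path_gens K n w) (2 * W - 1) /\
  depth_eq (path_gens K n w)
    (if n == 4 then (if w 1%N == 1%N then 2 else 1) else 1)%N.
Proof.
move=> n24 w0 [i [ni wi]] ic W.
have WE : (w i <= W)%N by apply: (leq_bigmax (Ordinal ni)).
have {WE wi} : (1 < W)%N by apply: leq_trans WE.
rewrite {}/W; case: n n24 w0 ic {i ni} => [|[|[|[|[|//]]]]] // _ w0 ic;
  rewrite !big_ord_recl big_ord0 maxn0 /= => W.
- apply: (@reg_depth_path2 _ _ _ (@Ordinal 2 0 isT) (@Ordinal 2 1 isT)) => //.
    exact: w0.
  exact: in_path_ideal2.
- by apply: reg_depth_path_gens3 => //; apply: w0.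
- by apply: reg_depth_path_gens4 => //; apply: w0.
Qed.
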